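(* Let $x^\star\in\mathbb{R}^n$ be a local minimum of (MPBVC) at which GCQ holds. Then the classic KKT conditions for (MPBVC) at $x^\star$ and strong stationarity of $x^\star$ for (MPBVC) are equivalent: $x^\star$ satisfies the classic KKT conditions if and only if it is strongly stationary.
   Context: Setting. Let $f,H_i,G_{i,j}:\mathbb{R}^n\to\mathbb{R}$ ($1\le i\le n_H$, $1\le j\le n_G$, with $n_H,n_G\ge1$), $g:\mathbb{R}^n\to\mathbb{R}^{n_g}$, $h:\mathbb{R}^n\to\mathbb{R}^{n_h}$ be twice continuously differentiable. (MPBVC) is the problem: minimize $f(x)$ subject to $g(x)=0$, $h(x)\ge0$, $H_i(x)\ge0$ for all $i$, and $G_{i,j}(x)H_i(x)\ge0$ for all $(i,j)$. Its feasible set is $X$. Index sets at a feasible point $x^\star$: let $\mathcal{I}_{(+,+)},\mathcal{I}_{(+,0)}$ be the sets of $(i,j)$ with $H_i(x^\star)>0$ and $G_{i,j}(x^\star)>0$, $=0$ respectively; let $\mathcal{I}_{(0,+)},\mathcal{I}_{(0,0)},\mathcal{I}_{(0,-)}$ be the sets of $(i,j)$ with $H_i(x^\star)=0$ and $G_{i,j}(x^\star)>0$, $=0$, $<0$ respectively. For each of these, $\mathcal{I}^H_{(\cdot,\cdot)}=\{i\mid \exists j:(i,j)\in\mathcal{I}_{(\cdot,\cdot)}\}$. Let $\mathcal{I}_0^H=\{i\mid H_i(x^\star)=0\}$ and $\mathcal{I}_h=\{l\mid h_l(x^\star)=0\}$. Cones. The tangent cone is $\mathcal{T}(X,x^\star)=\{d\in\mathbb{R}^n\mid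 \exists\, x^{(k)}\in X,\ t^{(k)}>0,\ t^{(k)}\to0,\ x^{(k)}\to x^\star,\ (x^{(k)}-x^\star)/t^{(k)}\to d\}$. The linearized cone $\mathcal{L}(x^\star)$ of (MPBVC) is, explicitly, the set of $d\in\mathbb{R}^n$ with $\nabla g_k(x^\star)^Td=0$ for all $k$; $\nabla h_l(x^\star)^Td\ge0$ for $l\in\mathcal{I}_h$; $\nabla H_i(x^\star)^Td=0$ for $i\in\mathcal{I}^H_{(0,-)}$; $\nabla H_i(x^\star)^Td\ge0$ for $i\in\mathcal{I}^H_{(0,0)}\cup\mathcal{I}^H_{(0,+)}$; $\nabla G_{i,j}(x^\star)^Td\ge0$ for $(i,j)\in\mathcal{I}_{(+,0)}$. The polar cone of $M\subseteq\mathbb{R}^n$ is $M^-=\{d\mid\langle d,x\rangle\le0\ \forall x\in M\}$. The Guignard constraint qualification (GCQ) holds at $x^\star$ if $\mathcal{L}(x^\star)^-=\mathcal{T}(X,x^\star)^-$. Classic KKT conditions at $x^\star$: $x^\star$ is feasible and there exist $\lambda^g\in\mathbb{R}^{n_g}$, $\lambda^h\in\mathbb{R}^{n_h}$, $\lambda^H\in\mathbb{R}^{n_H}$, $\lambda^{GH}\in\mathbb{R}^{n_G\cdot n_H}$ with $\lambda^h,\lambda^H,\lambda^{GH}\ge0$, $\lambda^h_lh_l(x^\star)=0$, $\lambda^H_iH_i(x^\star)=0$, $\lambda^{GH}_{ij}H_i(x^\star)G_{i,j}(x^\star)=0$ for all indices, and $\nabla f(x^\star)-\sum_k\lambda^g_k\nabla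 g_k(x^\star)-\sum_l\lambda^h_l\nabla h_l(x^\star)-\sum_i\lambda^H_i\nabla H_i(x^\star)-\sum_{(i,j)}\lambda^{GH}_{ij}\nabla(H_iG_{i,j})(x^\star)=0$. Strong stationarity of $x^\star$: there exist $\mu^g\in\mathbb{R}^{n_g}$, $\mu^h\in\mathbb{R}^{n_h}$, $\mu^G\in\mathbb{R}^{n_G\cdot n_H}$, $\mu^H\in\mathbb{R}^{n_H}$ with $\nabla f(x^\star)-\sum_{k}\mu^g_k\nabla g_k(x^\star)-\sum_{l}\mu^h_l\nabla h_l(x^\star)-\sum_{(i,j)}\mu^G_{ij}\nabla G_{i,j}(x^\star)-\sum_i\mu^H_i\nabla H_i(x^\star)=0$; $g(x^\star)=0$; $\mu^h_l\ge0$, $h_l(x^\star)\ge0$, $\mu^h_lh_l(x^\star)=0$ for all $l$; $\mu^H_i=0$ for $i\in\mathcal{I}^H_{(+,+)}\cup\mathcal{I}^H_{(+,0)}$; $\mu^H_i\ge0$ for $i\in\mathcal{I}_0^H$ such that no $j$ satisfies $(i,j)\in\mathcal{I}_{(0,-)}$; $\mu^H_i$ free for $i\in\mathcal{I}_0^H$ such that some $j$ satisfies $(i,j)\in\mathcal{I}_{(0,-)}$; $\mu^G_{ij}\ge0$ for $(i,j)\in\mathcal{I}_{(+,0)}$ and $\mu^G_{ij}=0$ otherwise. *)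

(* Defs.v *)
From HB Require Import structures.
From mathcomp Require Import all_boot all_order all_algebra.
From mathcomp Require Import all_classical all_reals all_analysis.

Set Implicit Arguments.
Unset Strict Implicit.
Unset Printing Implicit Defensive.

Import Order.TTheory GRing.Theory Num.Theory.
Import numFieldNormedType.Exports.

Local Open Scope classical_set_scope.
Local Open Scope ring_scope.

(* R^n is 'rV[R]_n; its library norm is the sup norm, which
   induces the usual topology, so limits and neighbourhoods are the Euclidean
   ones. *)

Section Calculus.
Variables (R : realType) (n : nat).
Implicit Types (phi : 'rV[R]_n -> R) (u v x d : 'rV[R]_n) (M : set 'rV[R]_n).

Definition inner u v : R := \sum_(i < n) u 0 i * v 0 i.

Definition partial (i : 'I_n) phi : 'rV[R]_n -> R :=
  fun x => 'D_(delta_mx 0 i) phi x.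

Definition grad phi x : 'rV[R]_n := \row_(i < n) partial i phi x.

(* [differentiable] is Frechet differentiability; continuity of the derivative
   is that of its finitely many coordinates, the partial derivatives. *)
Definition C1 phi : Prop :=
  (forall x, differentiable phi x) /\
  (forall i, continuous (partial i phi)).

Definition C2 phi : Prop := C1 phi /\ (forall i, C1 (partial i phi)).

Definition tangent_cone (X : set 'rV[R]_n) x : set 'rV[R]_n :=
  [set d | exists (xs : nat -> 'rV[R]_n) (t : nat -> R),
     [/\ forall k, X (xs k),
         forall k, 0 < t k,
         t @ \oo --> (0 : R),
         xs @ \oo --> x
       & (fun k => (t k)^-1 *: (xs k - x)) @ \oo --> d] ].

Definition polar M : set 'rV[R]_n := [set d | forall x, M x -> inner d x <= 0].

End Calculus.

(* H and G are kept as indexed families, g and h as vector-valued maps. *)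
Record mpbvc (R : realType) (n ng nh nH nG : nat) := Mpbvc {
  obj : 'rV[R]_n -> R;
  eqc : 'rV[R]_n -> 'rV[R]_ng;
  ineqc : 'rV[R]_n -> 'rV[R]_nh;
  Hc : 'I_nH -> 'rV[R]_n -> R;
  Gc : 'I_nH -> 'I_nG -> 'rV[R]_n -> R
}.

Section MPBVC.
Variables (R : realType) (n ng nh nH nG : nat).
Variable P : mpbvc R n ng nh nH nG.
Implicit Types (x d : 'rV[R]_n).

Local Notation f := (obj P).
Local Notation g := (eqc P).
Local Notation h := (ineqc P).
Local Notation H := (Hc P).
Local Notation G := (Gc P).

Definition C2_data : Prop :=
  [/\ C2 f,
      forall k, C2 (fun y => g y 0 k),
      forall l, C2 (fun y => h y 0 l),
      forall i, C2 (H i)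
    & forall i j, C2 (G i j)].

Definition feasible_set : set 'rV[R]_n :=
  [set x | [/\ g x = 0,
               forall l, 0 <= h x 0 l,
               forall i, 0 <= H i x
             & forall i j, 0 <= G i j x * H i x] ].

Definition local_minimum x : Prop :=
  feasible_set x /\ \forall y \near x, feasible_set y -> f x <= f y.

(* Index sets at x: the first letter is the sign of H i x, the second one that
   of G i j x (p for positive, z for zero, m for negative). *)
Definition I_pp x : set ('I_nH * 'I_nG) :=
  [set ij | 0 < H ij.1 x /\ 0 < G ij.1 ij.2 x].
Definition I_pz x : set ('I_nH * 'I_nG) :=
  [set ij | 0 < H ij.1 x /\ G ij.1 ij.2 x = 0].
Definition I_zp x : set ('I_nH * 'I_nG) :=
  [set ij | H ij.1 x = 0 /\ 0 < G ij.1 ij.2 x].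
Definition I_zz x : set ('I_nH * 'I_nG) :=
  [set ij | H ij.1 x = 0 /\ G ij.1 ij.2 x = 0].
Definition I_zm x : set ('I_nH * 'I_nG) :=
  [set ij | H ij.1 x = 0 /\ G ij.1 ij.2 x < 0].

Definition projH (A : set ('I_nH * 'I_nG)) : set 'I_nH :=
  [set i | exists j, A (i, j)].

Definition IH_0 x : set 'I_nH := [set i | H i x = 0].
Definition I_h x : set 'I_nh := [set l | h x 0 l = 0].

Definition linearized_cone x : set 'rV[R]_n :=
  [set d |
    (forall k, inner (grad (fun y => g y 0 k) x) d = 0) /\
    (forall l, I_h x l -> 0 <= inner (grad (fun y => h y 0 l) x) d) /\
    (forall i, projH (I_zm x) i -> inner (grad (H i) x) d = 0) /\
    (forall i, (projH (I_zz x) `|` projH (I_zp x)) i ->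
       0 <= inner (grad (H i) x) d) /\
    (forall i j, I_pz x (i, j) -> 0 <= inner (grad (G i j) x) d)].

Definition GCQ x : Prop :=
  polar (linearized_cone x) = polar (tangent_cone feasible_set x).

Definition classic_KKT x : Prop :=
  feasible_set x /\
  exists (lg : 'rV[R]_ng) (lh : 'rV[R]_nh) (lH : 'rV[R]_nH)
         (lGH : 'M[R]_(nH, nG)),
    (forall l, 0 <= lh 0 l) /\
    (forall i, 0 <= lH 0 i) /\
    (forall i j, 0 <= lGH i j) /\
    (forall l, lh 0 l * h x 0 l = 0) /\
    (forall i, lH 0 i * H i x = 0) /\
    (forall i j, lGH i j * (H i x * G i j x) = 0) /\
    grad f x
      - \sum_(k < ng) lg 0 k *: grad (fun y => g y 0 k) x
      - \sum_(l < nh) lh 0 l *: grad (fun y => h y 0 l) x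
      - \sum_(i < nH) lH 0 i *: grad (H i) x
      - \sum_(i < nH) \sum_(j < nG)
          lGH i j *: grad (fun y => H i y * G i j y) x = 0.

(* The sign of mH 0 i is left unconstrained when H i x = 0 and some
   (i, j) lies in I_zm x. *)
Definition strongly_stationary x : Prop :=
  exists (mg : 'rV[R]_ng) (mh : 'rV[R]_nh) (mG : 'M[R]_(nH, nG))
         (mH : 'rV[R]_nH),
    grad f x
      - \sum_(k < ng) mg 0 k *: grad (fun y => g y 0 k) x
      - \sum_(l < nh) mh 0 l *: grad (fun y => h y 0 l) x
      - \sum_(i < nH) \sum_(j < nG) mG i j *: grad (G i j) x
      - \sum_(i < nH) mH 0 i *: grad (H i) x = 0 /\
    g x = 0 /\
    (forall l, [/\ 0 <= mh 0 l, 0 <= h x 0 l & mh 0 l * h x 0 l = 0]) /\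
    (forall i, (projH (I_pp x) `|` projH (I_pz x)) i -> mH 0 i = 0) /\
    (forall i, IH_0 x i -> ~ (exists j, I_zm x (i, j)) -> 0 <= mH 0 i) /\
    (forall i j, I_pz x (i, j) -> 0 <= mG i j) /\
    (forall i j, ~ I_pz x (i, j) -> mG i j = 0).

End MPBVC.

(* Main.v *)
Require Import Defs.
From mathcomp Require Import all_boot all_order all_algebra.
From mathcomp Require Import all_classical all_reals all_analysis.

(** By the product rule, [grad (H_i G_ij) = H_i grad G_ij + G_ij grad H_i], so
    KKT multipliers give stationarity multipliers
    [mG_ij = lGH_ij H_i] and [mH_i = lH_i + sum_j lGH_ij G_ij]. This map is onto:
    where [H_i > 0] one divides by [H_i], and where [H_i = 0] a negative [mH_i]
    occurs only if some [G_ij < 0], on which [lGH_ij = mH_i / G_ij] can be put. *)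

Set Implicit Arguments.
Unset Strict Implicit.
Unset Printing Implicit Defensive.

Import Order.TTheory GRing.Theory Num.Theory.
Import numFieldNormedType.Exports.

Local Open Scope classical_set_scope.
Local Open Scope ring_scope.

Lemma gradM (R : realType) (n : nat) (phi psi : 'rV[R]_n -> R) (x : 'rV[R]_n) :
  differentiable phi x -> differentiable psi x ->
  grad (fun y => phi y * psi y) x = phi x *: grad psi x + psi x *: grad phi x.
Proof.
move=> dphi dpsi; apply/rowP => i; rewrite !mxE /partial.
by have -> := deriveM (diff_derivable (v := delta_mx 0 i) dphi)
                      (diff_derivable (v := delta_mx 0 i) dpsi).
Qed.

Section Multipliers.
Variables (R : realType) (n ng nh nH nG : nat) (P : mpbvc R n ng nh nH nG).
Hypothesis P_C2 : C2_data P.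
Variable x : 'rV[R]_n.
Local Notation H := (Hc P).
Local Notation G := (Gc P).

(** The identity holds for each [i] separately: after the product rule, [mG i j] collects the
    coefficient of [grad (G i j) x] and [mH 0 i] that of [grad (H i) x]. *)
Lemma sum_grad_HG (lH mH : 'rV[R]_nH) (lGH mG : 'M[R]_(nH, nG)) :
    (forall i j, mG i j = lGH i j * H i x) ->
    (forall i, mH 0 i = lH 0 i + \sum_(j < nG) lGH i j * G i j x) ->
  \sum_(i < nH) lH 0 i *: grad (H i) x
  + \sum_(i < nH) \sum_(j < nG) lGH i j *: grad (fun y => H i y * G i j y) x
  = \sum_(i < nH) \sum_(j < nG) mG i j *: grad (G i j) x
  + \sum_(i < nH) mH 0 i *: grad (H i) x.
Proof.
case: P_C2 => _ _ _ C2H C2G mGE mHE; rewrite -!big_split /=.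
apply: eq_bigr => i _; rewrite mHE scalerDl scaler_suml addrCA -big_split /=.
congr (_ + _); apply: eq_bigr => j _.
rewrite gradM ?mGE; [|exact: (C2H i).1.1|exact: (C2G i j).1.1].
by rewrite scalerDr !scalerA.
Qed.

Hypothesis x_feas : feasible_set P x.

(** If [H i x > 0], complementarity forces [lH = 0] and every [lGH j * G i j x = 0]. If [H i x = 0]
    and no [G i j x] is negative, all terms of the new multiplier are nonnegative. *)
Lemma stationarity_multipliers_of_KKT (i : 'I_nH) (lH : R) (lGH : 'I_nG -> R) :
    0 <= lH -> (forall j, 0 <= lGH j) -> lH * H i x = 0 ->
    (forall j, lGH j * (H i x * G i j x) = 0) ->
  [/\ (projH (I_pp P x) `|` projH (I_pz P x)) i ->
        lH + \sum_(j < nG) lGH j * G i j x = 0,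
      IH_0 P x i -> ~ (exists j, I_zm P x (i, j)) ->
        0 <= lH + \sum_(j < nG) lGH j * G i j x,
      forall j, 0 <= lGH j * H i x
    & forall j, ~ I_pz P x (i, j) -> lGH j * H i x = 0].
Proof.
case: x_feas => _ _ H_ge0 GH_ge0 lH_ge0 lGH_ge0 lHH lGHH; split.
- move=> Hpos; have {}Hpos : H i x != 0.
    by rewrite gt_eqF//; case: Hpos => -[j []].
  have -> : lH = 0 by move/eqP: lHH; rewrite mulf_eq0 (negPf Hpos) orbF => /eqP.
  rewrite add0r big1// => j _; apply: (mulfI Hpos).
  by rewrite mulr0 mulrCA lGHH.
- move=> Hi0 nzm; apply: addr_ge0 => //; apply: sumr_ge0 => j _.
  by rewrite mulr_ge0// leNgt; apply/negP => Gneg; apply: nzm; exists j.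
- by move=> j; rewrite mulr_ge0.
(* Outside [I_pz], either [H i x = 0] or [G i j x] is nonzero and can be cancelled from the
   complementarity equation. *)
- move=> j npz; have [->|Hi0] := eqVneq (H i x) 0; first by rewrite mulr0.
  have [Gz|Gnz] := eqVneq (G i j x) 0.
    by case: npz; split => //=; rewrite lt_neqAle eq_sym Hi0 H_ge0.
  by apply: (mulIf Gnz); rewrite mul0r -mulrA lGHH.
Qed.

(** Right inverse of the multiplier map at a fixed [i]. The multipliers are bundled into one pair so
    that a single choice over [i] yields them all. *)
Lemma KKT_multipliers_of_stationarity (i : 'I_nH) (mH : R) (mG : 'I_nG -> R) :
    (0 < nG)%N ->
    ((projH (I_pp P x) `|` projH (I_pz P x)) i -> mH = 0) ->
    (IH_0 P x i -> ~ (exists j, I_zm P x (i, j)) -> 0 <= mH) ->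
    (forall j, I_pz P x (i, j) -> 0 <= mG j) ->
    (forall j, ~ I_pz P x (i, j) -> mG j = 0) ->
  exists lHG : R * {ffun 'I_nG -> R},
    [/\ 0 <= lHG.1 /\ (forall j, 0 <= lHG.2 j), lHG.1 * H i x = 0,
        forall j, lHG.2 j * (H i x * G i j x) = 0,
        forall j, mG j = lHG.2 j * H i x
      & mH = lHG.1 + \sum_(j < nG) lHG.2 j * G i j x].
Proof.
case: x_feas => _ _ H_ge0 GH_ge0 nG_gt0 mH_pos mH_zero mG_ge0 mG_eq0.
(* On [I_pz] the factor [G i j x] vanishes, elsewhere [mG j] does. *)
have mGG j : mG j * G i j x = 0.
  have [[_ /= ->]|/mG_eq0 ->] := pselect (I_pz P x (i, j)); first exact: mulr0.
  exact: mul0r.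
have [Hi0|Hi_neq0] := eqVneq (H i x) 0.
  have mG0 j : mG j = 0 by apply: mG_eq0 => -[/=]; rewrite Hi0 ltxx.
  have [mH_ge0|mH_lt0] := leP 0 mH.
    exists (mH, [ffun=> 0]); split=> /= [|||j|].
    + by split=> // j; rewrite ffunE.
    + by rewrite Hi0 mulr0.
    + by move=> j; rewrite ffunE mul0r.
    + by rewrite mG0 Hi0 mulr0.
    + by rewrite big1 ?addr0// => j _; rewrite ffunE mul0r.
  have [j0 [_ /= Gj0]] : exists j, I_zm P x (i, j).
    by apply: contrapT => /(mH_zero Hi0); rewrite leNgt mH_lt0.
  (* The only nonzero entry is a quotient of two negative numbers, hence positive; complementarity
     is automatic because [H i x = 0]. *)
  exists (0, [ffun j => if j == j0 then mH / G i j0 x else 0]).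
  split=> /= [||j|j|].
  + split=> // j; rewrite ffunE; case: ifP => // _.
    by rewrite ltW// nmulr_lgt0// invr_lt0.
  + exact: mul0r.
  + by rewrite Hi0 mul0r mulr0.
  + by rewrite mG0 Hi0 mulr0.
  + rewrite add0r (bigD1 j0)//= ffunE eqxx divfK ?lt_eqF// big1 ?addr0//.
    by move=> j /negPf nj; rewrite ffunE nj mul0r.
have Hi_gt0 : 0 < H i x by rewrite lt_neqAle eq_sym Hi_neq0 H_ge0.
have mH0 : mH = 0.
  (* Membership in a projected index set needs some [j], and any will do: feasibility with
     [H i x > 0] gives [G i j x >= 0], so [(i, j)] lies in [I_pp] or [I_pz]. *)
  apply: mH_pos; pose j := Ordinal nG_gt0.
  have := GH_ge0 i j; rewrite pmulr_lge0// le_eqVlt => /orP[/eqP Gz|Gpos].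
    by right; exists j.
  by left; exists j.
(* Dividing by [H i x] keeps signs, and by [mGG] the sum contributes nothing to [mH = 0]. *)
exists (0, [ffun j => mG j / H i x]); split=> /= [||j|j|].
- split=> // j; rewrite ffunE mulr_ge0 ?invr_ge0//.
  by have [/mG_ge0//|/mG_eq0 ->] := pselect (I_pz P x (i, j)).
- exact: mul0r.
- by rewrite ffunE mulrA divfK.
- by rewrite ffunE divfK.
- by rewrite add0r big1// => j _; rewrite ffunE mulrAC mGG mul0r.
Qed.

End Multipliers.

Theorem theorem3 (R : realType) (n ng nh nH nG : nat)
  (nH_gt0 : (0 < nH)%N) (nG_gt0 : (0 < nG)%N)
  (P : mpbvc R n ng nh nH nG) (P_C2 : C2_data P)
  (x : 'rV[R]_n) (x_min : local_minimum P x) (x_GCQ : GCQ P x) :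
  classic_KKT P x <-> strongly_stationary P x.
Proof.
have x_feas := x_min.1; case: (x_feas) => g0 h_ge0 _ _; split.
  case=> _ [lg [lh [lH [lGH [lh_ge0 [lH_ge0 [lGH_ge0 [lhh [lHH [lGHH eq0]]]]]]]]]].
  pose mG : 'M[R]_(nH, nG) := \matrix_(i, j) (lGH i j * Hc P i x).
  pose mH : 'rV[R]_nH := \row_i (lH 0 i + \sum_(j < nG) lGH i j * Gc P i j x).
  have M i := stationarity_multipliers_of_KKT x_feas
    (lH_ge0 i) (lGH_ge0 i) (lHH i) (lGHH i).
  exists lg, lh, mG, mH; split.
    (* The last two subtracted sums are merged into one, which is then exchanged as a whole. *)
    rewrite -addrA -opprD -(sum_grad_HG P_C2 (lH := lH) (lGH := lGH)).
    + by rewrite opprD addrA.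
    + by move=> i j; rewrite mxE.
    + by move=> i; rewrite mxE.
  split=> //; split=> //.
  split; first by move=> i; rewrite mxE; case: (M i).
  split; first by move=> i Hi0 nzm; rewrite mxE; case: (M i) => _ ->.
  split=> i j; first by move=> _; rewrite mxE; case: (M i).
  by rewrite mxE; case: (M i) => _ _ _; exact.
case=> mg [mh [mG [mH [eq0 [_ [mhP [mH_pos [mH_zero [mG_ge0 mG_eq0]]]]]]]]].
have /choice[l lP] i := KKT_multipliers_of_stationarity x_feas nG_gt0
  (mH_pos i) (mH_zero i) (mG_ge0 i) (mG_eq0 i).
split=> //; exists mg, mh, (\row_i (l i).1), (\matrix_(i, j) (l i).2 j).
split; first by move=> k; case: (mhP k).
split; first by move=> i; rewrite mxE; case: (lP i) => -[].
split; first by move=> i j; rewrite mxE; case: (lP i) => -[].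
split; first by move=> k; case: (mhP k).
split; first by move=> i; rewrite mxE; case: (lP i).
split; first by move=> i j; rewrite mxE; case: (lP i).
rewrite -addrA -opprD (sum_grad_HG P_C2 (mH := mH) (mG := mG)).
- by rewrite opprD addrA.
- by move=> i j; rewrite mxE; case: (lP i).
- move=> i; rewrite mxE; case: (lP i) => _ _ _ _ ->.
  by congr (_ + _); apply: eq_bigr => j _; rewrite mxE.
Qed.
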